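(* Let $a,b$ be positive integers, let $x_F$ be the Fibonacci word (the fixed point of $0\mapsto01$, $1\mapsto0$), let $\mathcal{L}_F$ be the set of nonempty finite factors of $x_F$, and let $S:\mathcal{L}_F\to\mathbb{N}$ be the homomorphism $S(w)=a|w|_0+b|w|_1$. Suppose $\mathbb{N}\setminus S(\mathcal{L}_F)$ is infinite, let $C$ be its increasing enumeration and $\Delta C=(C(n+1)-C(n))_{n\ge1}$. Then there exist a morphism $\tau$ on a two-letter alphabet with a fixed point $z$, and a morphism $\delta$ from that alphabet to finite words over the positive integers, such that $\Delta C=\delta(z)$.
   Context: $\mathbb{N}=\{1,2,3,\dots\}$. $|w|_0,|w|_1$ denote the numbers of occurrences of $0$ and $1$ in $w$. A fixed point of $\tau$ is an infinite word $z$ with $\tau(z)=z$; $\delta(z)$ is the concatenation $\delta(z_1)\delta(z_2)\cdots$. *)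

(* Defs.v *)
From mathcomp Require Import all_boot.
From mathcomp Require Import classical_sets cardinality.

Set Implicit Arguments.
Unset Strict Implicit.
Unset Printing Implicit Defensive.

Local Open Scope classical_set_scope.

(* Infinite words are functions on nat: the letter written w_(n+1) in the usual
   1-based notation is [w n]. A morphism of free monoids A* -> B* is given by
   the images of the letters, f : A -> seq B. *)

Definition extend (A B : Type) (f : A -> seq B) (w : seq A) : seq B :=
  flatten (map f w).

(* f(x) = y for infinite words x, y. As f may erase letters, the second clause
   is needed to say that the concatenation f(x_1)f(x_2)... is infinite. *)
Definition maps_to (A B : Type) (f : A -> seq B) (x : nat -> A)
    (y : nat -> B) : Prop :=
  (forall n, let u := extend f (mkseq x n) in u = mkseq y (size u)) /\
  (forall k, exists n, k <= size (extend f (mkseq x n))).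

Definition fixed_point (A : Type) (f : A -> seq A) (x : nat -> A) : Prop :=
  maps_to f x x.

(* The binary alphabet is bool: false is the letter 0 and true the letter 1. *)
Definition fib_morphism (c : bool) : seq bool :=
  if c then [:: false] else [:: false; true].

Definition nonempty_factors (A : Type) (x : nat -> A) : set (seq A) :=
  [set w | w <> [::] /\
           exists i, w = mkseq (fun j => x (i + j)) (size w)].

Definition weight (a b : nat) (w : seq bool) : nat :=
  a * count_mem false w + b * count_mem true w.

(* The positive integers outside S(L), where L is the language of x. *)
Definition weight_gaps (a b : nat) (x : nat -> bool) : set nat :=
  [set n | 0 < n] `\` (weight a b @` nonempty_factors x).

(* [C n] is the (n+1)-st element of E. *)
Definition increasing_enumeration (E : set nat) (C : nat -> nat) : Prop :=
  {homo C : m n / m < n} /\ range C = E.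

(* The truncated subtraction is exact when C is increasing. *)
Definition differences (C : nat -> nat) (n : nat) : nat := C n.+1 - C n.

Lemma extend_cat (A B : Type) (f : A -> seq B) u v :
  extend f (u ++ v) = extend f u ++ extend f v.
Proof. by rewrite /extend map_cat flatten_cat. Qed.

Lemma size_extend_fib w :
  size (extend fib_morphism w) = size w + count_mem false w.
Proof.
elim: w => //= c w IH; rewrite /extend /= size_cat -/(extend _ _) IH.
by case: c; rewrite /= ?add0n !addSn ?add0n // addnS.
Qed.

Lemma take_mkseq (A : Type) (x : nat -> A) k n :
  k <= n -> take k (mkseq x n) = mkseq x k.
Proof. by move=> le_kn; rewrite /mkseq -map_take take_iota (minn_idPl le_kn). Qed.

Lemma fixed_point_fib_unique x y :
  fixed_point fib_morphism x -> fixed_point fib_morphism y -> x =1 y.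
Proof.
move=> [hx _] [hy _].
have head z : (forall n, let u := extend fib_morphism (mkseq z n) in
    u = mkseq z (size u)) -> z 0 = false.
  by move=> /(_ 1); rewrite /extend /=; case E: (z 0); rewrite /mkseq /= ?E.
have x0 := head _ hx; have y0 := head _ hy.
suff eqn n : mkseq x n.+1 = mkseq y n.+1.
  move=> n; have := congr1 (fun s => nth false s n) (eqn n).
  by rewrite !nth_mkseq.
elim: n => [|n IH]; first by rewrite /mkseq /= x0 y0.
have := hy n.+1; rewrite -IH; have := hx n.+1.
set u := extend _ _; have nu : n.+2 <= size u.
  by rewrite size_extend_fib size_mkseq -[n.+2]addn1 leq_add2l /= x0.
move=> /= ux uy; rewrite -(take_mkseq x nu) -(take_mkseq y nu).
by rewrite -ux -uy.
Qed.

Lemma fixed_point_fib_exists : exists x, fixed_point fib_morphism x.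
Proof.
pose W n := iter n (extend fib_morphism) [:: false].
have WS n : exists v, W n.+1 = W n ++ v.
  elim: n => [|n [v IH]]; first by exists [:: true].
  exists (extend fib_morphism v).
  by have := congr1 (extend fib_morphism) IH; rewrite extend_cat.
have WD n m : exists v, W (n + m) = W n ++ v.
  elim: m => [|m [v IH]]; first by exists [::]; rewrite addn0 cats0.
  have [v' E] := WS (n + m); exists (v ++ v').
  by rewrite addnS E IH catA.
have sW n : n < size (W n).
  elim: n => // n IH.
  have -> : W n.+1 = extend fib_morphism (W n) by [].
  rewrite size_extend_fib -addn1 -addn1 -addnA addnA.
  apply: leq_add; first by rewrite addn1.
  by have [v ->] := WD 0 n.
pose x i := nth false (W i) i.
have xW n k : k <= size (W n) -> mkseq x k = take k (W n).
  move=> le_k; apply: (@eq_from_nth _ false).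
    by rewrite size_mkseq size_takel.
  move=> i; rewrite size_mkseq => lt_ik; rewrite nth_mkseq // nth_take //.
  have lt_in := leq_trans lt_ik le_k.
  case: (leqP i n) => [/subnKC <-|/ltnW /subnKC E].
    by have [v ->] := WD i (n - i); rewrite nth_cat sW.
  by rewrite /x -[in W i]E; have [v ->] := WD n (i - n); rewrite nth_cat lt_in.
exists x; split=> [n|k]; last first.
  by exists k; rewrite size_extend_fib size_mkseq leq_addr.
rewrite (xW n n (ltnW (sW n))) /=.
have E : W n.+1 = extend fib_morphism (take n (W n)) ++
                  extend fib_morphism (drop n (W n)).
  by rewrite -extend_cat cat_take_drop.
rewrite (xW n.+1); first by rewrite E take_size_cat.
by rewrite E size_cat leq_addr.
Qed.

(* Main.v *)
(** Let [u] be the Fibonacci word preceded by its letter [g] of larger weight, and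
    let [D = |b - a|]. As the Fibonacci word is balanced and its prefixes are left
    special, [s > 0] is the weight of a factor iff [s] or [s + D] is the weight of
    a prefix of [u]. Moreover [u] is itself fixed by a morphism [tau] on two letters.
    All the blocks [tau^k c] start with one long prefix [q] of [u], so what follows a
    block in [u] is known over a distance as large as we wish. Cut [u] into these
    blocks, and let [c0] be the least gap. If a block occupies the weights from [s]
    to [t], then the gaps [n] with [s + c0 < n <= t + c0] depend on that block only,
    and the last of them is [t + c0]; the differences ending at these gaps form the
    image of the block's letter. *)

Require Import Defs.
From mathcomp Require Import all_boot.
From mathcomp Require Import classical_sets cardinality.
From mathcomp Require Import zify.

Set Implicit Arguments.
Unset Strict Implicit.
Unset Printing Implicit Defensive.

(** * Words, morphisms and weights of prefixes *)

Lemma mkseqD (A : Type) (x : nat -> A) m n :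
  mkseq x (m + n) = mkseq x m ++ mkseq (fun j => x (m + j)) n.
Proof. by rewrite /mkseq iotaD map_cat add0n -[m in iota m n]addn0 iotaDl -map_comp. Qed.

Lemma extend_seq1 (A B : Type) (f : A -> seq B) c : extend f [:: c] = f c.
Proof. by rewrite /extend /= cats0. Qed.

Lemma extend_mkseqS (A B : Type) (f : A -> seq B) (x : nat -> A) n :
  extend f (mkseq x n.+1) = extend f (mkseq x n) ++ f (x n).
Proof. by rewrite mkseqS -cats1 extend_cat extend_seq1. Qed.

Lemma size_extend_ge (A B : Type) (f : A -> seq B) k w :
  (forall c, k <= size (f c)) -> k * size w <= size (extend f w).
Proof.
move=> hf; elim: w => [|c w IH]; first by rewrite muln0.
by rewrite /extend /= size_cat mulnS leq_add.
Qed.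

Lemma extend_comp (A B D : Type) (f : A -> seq B) (h : B -> seq D) w :
  extend (fun c => extend h (f c)) w = extend h (extend f w).
Proof. by elim: w => //= c w IH; rewrite [LHS]/extend /= -/(extend _ w) IH -extend_cat. Qed.

Definition letter_sum (A : Type) (W : A -> nat) (w : seq A) := sumn (map W w).

Lemma letter_sum_cat (A : Type) (W : A -> nat) v w :
  letter_sum W (v ++ w) = letter_sum W v + letter_sum W w.
Proof. by rewrite /letter_sum map_cat sumn_cat. Qed.

Lemma letter_sum_ge_size (A : Type) (W : A -> nat) w :
  (forall c, 0 < W c) -> size w <= letter_sum W w.
Proof.
move=> hW; elim: w => //= c w IH; rewrite /letter_sum /= -add1n.
exact: leq_add.
Qed.

(** Boolean, so that gaps can be selected by [filter]. *)
Definition prefix_sum (A : Type) (W : A -> nat) (w : seq A) (m : nat) : bool :=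
  m \in [seq letter_sum W (take j w) | j <- iota 0 (size w).+1].

Lemma prefix_sumP (A : Type) (W : A -> nat) w m :
  reflect (exists v v', w = v ++ v' /\ letter_sum W v = m) (prefix_sum W w m).
Proof.
apply: (iffP mapP) => [[j _ ->]|[v [v' [-> <-]]]].
  by exists (take j w), (drop j w); rewrite cat_take_drop.
exists (size v); last by rewrite take_size_cat.
by rewrite mem_iota size_cat; lia.
Qed.

(** Letters have positive weight, so a prefix reaching beyond [w] weighs more than [w]. *)
Lemma prefix_sum_catl (A : Type) (W : A -> nat) w w' m :
  (forall c, 0 < W c) -> m <= letter_sum W w ->
  prefix_sum W (w ++ w') m = prefix_sum W w m.
Proof.
move=> hW le_m; apply/prefix_sumP/prefix_sumP => [[v [v' [E hv]]]|[v [v' [-> hv]]]].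
  case: (leqP (size v) (size w)) => hs.
    exists v, (drop (size v) w); split=> //.
    have := congr1 (take (size v)) E; rewrite takel_cat // take_size_cat // => Ev.
    by rewrite -{1}Ev cat_take_drop.
  have := congr1 (take (size w)) E; rewrite take_size_cat // takel_cat 1?ltnW // => Ew.
  have := letter_sum_ge_size (drop (size w) v) hW.
  have := cat_take_drop (size w) v; rewrite -Ew => /(congr1 (letter_sum W)).
  by rewrite letter_sum_cat size_drop; lia.
by exists v, (v' ++ w'); rewrite catA.
Qed.

(** A prefix shorter than [p] weighs less than [p], so the prefixes in question contain [p]. *)
Lemma prefix_sum_catr (A : Type) (W : A -> nat) p w m :
  (forall c, 0 < W c) ->
  prefix_sum W (p ++ w) (letter_sum W p + m) = prefix_sum W w m.
Proof.
move=> hW; apply/prefix_sumP/prefix_sumP => [[v [v' [E hv]]]|[v [v' [-> hv]]]].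
  case: (leqP (size p) (size v)) => hs.
    have := congr1 (take (size p)) E; rewrite take_size_cat // takel_cat // => Ep.
    have Ev := cat_take_drop (size p) v; rewrite -Ep in Ev.
    exists (drop (size p) v), v'; split.
      by move: E; rewrite -{1}Ev -catA => /(congr1 (drop (size p))); rewrite !drop_size_cat.
    by move: hv; rewrite -{1}Ev letter_sum_cat; lia.
  have := congr1 (take (size v)) E; rewrite takel_cat 1?ltnW // take_size_cat // => Ev.
  have := letter_sum_ge_size (drop (size v) p) hW.
  have := cat_take_drop (size v) p; rewrite Ev => /(congr1 (letter_sum W)).
  by rewrite letter_sum_cat size_drop; lia.
by exists (p ++ v), v'; rewrite catA letter_sum_cat hv.
Qed.

Definition avoids (A : Type) (W : A -> nat) (D : nat) (w : seq A) (n : nat) : bool :=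
  ~~ prefix_sum W w n && ~~ prefix_sum W w (n + D).

Lemma avoids_catl (A : Type) (W : A -> nat) D w w' n :
  (forall c, 0 < W c) -> n + D <= letter_sum W w ->
  avoids W D (w ++ w') n = avoids W D w n.
Proof.
move=> hW le_n; rewrite /avoids !prefix_sum_catl //.
by apply: leq_trans le_n; rewrite leq_addr.
Qed.

Lemma avoids_catr (A : Type) (W : A -> nat) D p w n :
  (forall c, 0 < W c) ->
  avoids W D (p ++ w) (letter_sum W p + n) = avoids W D w n.
Proof. by move=> hW; rewrite /avoids -addnA !prefix_sum_catr. Qed.

(** A prefix of weight [m] has at most [m] letters, so the first [L] letters of [u] settle which
    weights up to [L] occur. *)
Lemma avoids_mkseqP (A : Type) (W : A -> nat) D (u : nat -> A) L n :
  (forall c, 0 < W c) -> n + D <= L ->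
  reflect (forall j, letter_sum W (mkseq u j) <> n /\ letter_sum W (mkseq u j) <> n + D)
    (avoids W D (mkseq u L) n).
Proof.
move=> hW le_L.
have P m : m <= L -> reflect (exists j, letter_sum W (mkseq u j) = m)
    (prefix_sum W (mkseq u L) m).
  move=> le_m; apply: (iffP idP) => [/prefix_sumP [v [v' [E <-]]]|[j Ej]].
    exists (size v); have := congr1 (take (size v)) E.
    rewrite take_size_cat // take_mkseq => [-> //|].
    by have := congr1 size E; rewrite size_mkseq size_cat => ->; rewrite leq_addr.
  apply/prefix_sumP; have := letter_sum_ge_size (mkseq u j) hW.
  rewrite Ej size_mkseq => /leq_trans /(_ le_m) le_j.
  exists (mkseq u j), (drop j (mkseq u L)).
  by split=> //; rewrite -(take_mkseq u le_j) cat_take_drop.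
have le_nL : n <= L by apply: leq_trans le_L; rewrite leq_addr.
apply: (iffP andP) => [[h1 h2] j|h]; last first.
  by split; [apply/(P _ le_nL)|apply/(P _ le_L)] => -[j]; case: (h j).
by split=> E; [case/(P _ le_nL): h1|case/(P _ le_L): h2]; exists j.
Qed.

(** * Iterates of a morphism *)

Fixpoint iter_morphism (A : Type) (tau : A -> seq A) k (c : A) : seq A :=
  if k is k'.+1 then extend tau (iter_morphism tau k' c) else [:: c].

Lemma fixed_point_iter (A : Type) (tau : A -> seq A) u k n :
  fixed_point tau u -> let w := extend (iter_morphism tau k) (mkseq u n) in
  w = mkseq u (size w).
Proof.
move=> [hu _] /=; elim: k n => [|k IH] n.
  suff -> : extend (iter_morphism tau 0) (mkseq u n) = mkseq u n by rewrite size_mkseq.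
  by elim: (mkseq u n) => //= c w E; rewrite /extend /= -/(extend _ _) E.
by rewrite /= extend_comp IH; apply: hu.
Qed.

(** Applying [tau] to a common prefix of [u] at least doubles its length, and the result is again a
    prefix of [u]. *)
Lemma iter_morphism_prefix (A : Type) (tau : A -> seq A) u k c :
  fixed_point tau u ->
  (forall d, 1 < size (tau d)) -> (forall d, take 1 (tau d) = [:: u 0]) ->
  exists r, iter_morphism tau k.+1 c = mkseq u k.+1 ++ r.
Proof.
move=> [hu _] hsz hhd; elim: k => [|k [r IH]].
  exists (drop 1 (tau c)).
  by rewrite /= extend_seq1 -{1}(cat_take_drop 1 (tau c)) hhd.
set M := size (extend tau (mkseq u k.+1)).
have le_M : k.+2 <= M.
  have := @size_extend_ge _ _ tau 2 (mkseq u k.+1) hsz.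
  by rewrite size_mkseq -/M; lia.
exists (drop k.+2 (mkseq u M) ++ extend tau r).
rewrite -[iter_morphism _ _ _]/(extend tau (iter_morphism tau k.+1 c)) IH extend_cat hu -/M.
by rewrite catA -(take_mkseq u le_M) cat_take_drop.
Qed.

(** * Increasing enumerations and their differences *)

Lemma filter_increasing (E : set nat) (C : nat -> nat) (e : pred nat) N :
  increasing_enumeration E C -> (forall n, reflect (E n) (e n)) ->
  let s := [seq n <- iota (C 0).+1 N | e n] in s = mkseq (C \o succn) (size s).
Proof.
move=> [incC rC] eP /=.
have monoC m n : (C m < C n) = (m < n).
  apply/idP/idP; last exact: incC.
  by apply: contraTT; rewrite -leqNgt -leqNgt leq_eqVlt => /predU1P [->|/incC /ltnW].
have CE n : e (C n) by apply/eP; rewrite -rC; exists n.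
elim: N => // N; rewrite -[N.+1]addn1 iotaD filter_cat size_cat /=.
set s := [seq n <- iota (C 0).+1 N | e n] => IH; case: ifP; last first.
  by rewrite addn0 cats0.
move=> he; rewrite addn1 mkseqS -cats1 -IH; congr (_ ++ [:: _]).
set k := _ + N; rewrite -/k in he.
have [m _ Cm] : range C k by rewrite rC; apply/eP.
(* [C n.+1] lies in [s] iff [n.+1 < m], and by induction iff [n < size s]. The shift by one is there
   because the scan starts just after [C 0]. *)
suff Em : m = (size s).+1 by rewrite -Cm Em.
have mem_s n : (C n.+1 \in s) = (n.+1 < m).
  by rewrite mem_filter CE mem_iota -/k -Cm /= !monoC.
have mem_s' n : (C n.+1 \in s) = (n < size s).
  rewrite IH size_mkseq; apply/mapP/idP => [[j]|lt_n].
    rewrite mem_iota /= => lt_j E_C; have := monoC n.+1 j.+1; have := monoC j.+1 n.+1.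
    by rewrite E_C !ltnn; lia.
  by exists n => //; rewrite mem_iota.
have lt0m : 0 < m by rewrite -monoC Cm /k; lia.
apply/eqP; rewrite eqn_leq; apply/andP; split.
  by have := mem_s (size s); rewrite mem_s' ltnn => /esym/negbT; rewrite -leqNgt.
by case sz: (size s) => [|n] //; rewrite -mem_s mem_s' sz.
Qed.

Lemma pairmap_differences (C : nat -> nat) n :
  pairmap (fun i j => j - i) (C 0) (mkseq (C \o succn) n) = mkseq (differences C) n.
Proof.
apply: (@eq_from_nth _ 0); rewrite ?size_pairmap !size_mkseq // => i lt_i.
rewrite (nth_pairmap 0) ?size_mkseq // !nth_mkseq //; case: i lt_i => // i lt_i.
by rewrite /= nth_mkseq // ltnW.
Qed.

Lemma pairmap_shift k x s :
  pairmap (fun i j => j - i) (k + x) (map (addn k) s) = pairmap (fun i j => j - i) x s.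
Proof. by elim: s x => //= y s IH x; rewrite IH subnDl. Qed.

Lemma pairmap_sub_gt0 x s k :
  path ltn x s -> k \in pairmap (fun i j => j - i) x s -> 0 < k.
Proof.
elim: s x => //= y s IH x /andP [lt_xy hs]; rewrite inE => /predU1P [->|]; last exact: IH.
by rewrite subn_gt0.
Qed.

(** * Coding the gaps by blocks of a fixed point *)

Lemma gap_differences_morphic (A : Type) (W : A -> nat) (D : nat)
    (tau : A -> seq A) (u : nat -> A) (C : nat -> nat) :
  (forall c, 0 < W c) -> fixed_point tau u ->
  (forall c, 1 < size (tau c)) -> (forall c, take 1 (tau c) = [:: u 0]) ->
  increasing_enumeration [set n | 0 < n /\ forall j,
    letter_sum W (mkseq u j) <> n /\ letter_sum W (mkseq u j) <> n + D]%classic C ->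
  exists delta : A -> seq nat,
    (forall c k, k \in delta c -> 0 < k) /\ maps_to delta u (differences C).
Proof.
move=> hW hu hsz hhd; set E := (X in increasing_enumeration X) => hC.
pose e n := (0 < n) && avoids W D (mkseq u (n + D)) n.
have eP n : reflect (E n) (e n).
  apply: (iffP andP) => [[n0 /(avoids_mkseqP _ hW) h]|[n0 h]]; first by split=> //; apply: h.
  by split=> //; apply/(avoids_mkseqP _ hW).
have eL L n : 0 < n -> n + D <= L -> e n = avoids W D (mkseq u L) n.
  move=> n0 le_L; rewrite /e n0 /= -(subnKC le_L) [in RHS]mkseqD avoids_catl //.
  by apply: (leq_trans _ (letter_sum_ge_size _ hW)); rewrite size_mkseq.
pose c0 := C 0; have e0 : e c0 by apply/eP; case: hC => _ <-; exists 0.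
have c0_gt0 : 0 < c0 by case/andP: e0.
(* Gaps up to [c0] past the end of a block are tested on weights up to [c0 + D] past it; [q] has [K]
   letters and therefore weighs enough. *)
pose K := c0 + D; pose q := mkseq u K.
have Kq : K <= letter_sum W q.
  by apply: (leq_trans _ (letter_sum_ge_size _ hW)); rewrite size_mkseq.
pose B := iter_morphism tau K.
have Bq c : exists r, B c = q ++ r.
  have K_gt0 : 0 < K by rewrite ltn_addr.
  by rewrite /B /q -(prednK K_gt0); apply: iter_morphism_prefix.
pose wB c := letter_sum W (B c).
(* Weights are counted from the start of the block, where the last gap of the preceding block is
   [c0]; hence the starting value in [delta]. *)
pose L c := [seq n <- iota c0.+1 (wB c) | avoids W D (B c ++ q) n].
pose delta c := pairmap (fun i j => j - i) c0 (L c).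
pose F N := [seq n <- iota c0.+1 N | e n].
pose pre n := extend B (mkseq u n).
have pre_u n : pre n = mkseq u (size (pre n)) by exact: fixed_point_iter.
(* Seen from the end of [pre n], the word [u] continues with [B (u n)] and then [q]. *)
have e_shift n m : 0 < m -> m <= c0 + wB (u n) ->
    e (letter_sum W (pre n) + m) = avoids W D (B (u n) ++ q) m.
  move=> m0 le_m; have [r Er] := Bq (u n.+1).
  set w := pre n.+2; have Ew : w = (pre n ++ (B (u n) ++ q)) ++ r.
    by rewrite /w /pre !extend_mkseqS Er !catA.
  have hm : letter_sum W (pre n) + m + D <= letter_sum W (pre n ++ (B (u n) ++ q)).
    by rewrite !letter_sum_cat -/(wB _); move: Kq; rewrite /K; lia.
  rewrite (@eL (size w + (letter_sum W (pre n) + m + D))); [|lia|lia].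
  by rewrite mkseqD -pre_u -/w Ew -catA avoids_catl ?avoids_catr.
(* The block after [pre n] begins with [q], a prefix of [u], so the least gap [c0] recurs there. *)
have last_L n : e (letter_sum W (pre n) + c0).
  have [r Er] := Bq (u n); rewrite e_shift ?leq_addr // Er -catA avoids_catl //.
  by rewrite -(eL K).
have wpreS n : letter_sum W (pre n.+1) = letter_sum W (pre n) + wB (u n).
  by rewrite /pre extend_mkseqS letter_sum_cat.
have wB_gt0 c : 0 < wB c.
  have [r Er] := Bq c; rewrite /wB Er letter_sum_cat.
  by move: Kq; rewrite /K; lia.
have F_cat N M : F (N + M) = F N ++ [seq n <- iota (c0 + N).+1 M | e n].
  by rewrite /F iotaD filter_cat addSn.
have F_shift n : [seq m <- iota (c0 + letter_sum W (pre n)).+1 (wB (u n)) | e m]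
    = map (addn (letter_sum W (pre n))) (L (u n)).
  rewrite -addSn addnC iotaDl filter_map; congr (map _ _); apply: eq_in_filter => m.
  by rewrite mem_iota => /andP [lt_m le_m] /=; rewrite e_shift //; lia.
(* The scanned interval ends at a gap, so consecutive difference lists can be glued. For [n = 0] it
   is empty and the default [c0] is the right value. *)
have last_F n : last c0 (F (letter_sum W (pre n))) = c0 + letter_sum W (pre n).
  case: n => [|n]; first by rewrite addn0.
  have := last_L n.+1; rewrite wpreS addnC; have := wB_gt0 (u n).
  case: (wB (u n)) => // k _ he; rewrite -addn1 addnA F_cat last_cat /= addnS -addnS.
  by move: he; rewrite !addnS addn0 !addnA => ->.
have delta_F n : extend delta (mkseq u n) =
    pairmap (fun i j => j - i) c0 (F (letter_sum W (pre n))).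
  elim: n => // n IH; rewrite extend_mkseqS IH wpreS F_cat F_shift pairmap_cat last_F.
  by rewrite addnC pairmap_shift.
(* The gap closing the block is in [L c], so [delta] erases no letter. *)
have delta_size c : 1 <= size (delta c).
  rewrite size_pairmap -has_predT; apply/hasP; exists (wB c + c0) => //.
  rewrite mem_filter mem_iota avoids_catr // -(eL K) // e0 /=.
  by have := wB_gt0 c; lia.
exists delta; split=> [c k|].
  apply: pairmap_sub_gt0; rewrite path_sortedE; last exact: ltn_trans.
  rewrite sorted_filter ?iota_ltn_sorted //; last exact: ltn_trans.
  by rewrite andbT; apply/allP => i; rewrite mem_filter mem_iota => /and3P [].
split=> [n|k] /=; last first.
  by exists k; have := size_extend_ge (mkseq u k) delta_size; rewrite size_mkseq mul1n.
rewrite delta_F size_pairmap -pairmap_differences.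
by rewrite -(filter_increasing _ hC eP).
Qed.

(** * Balance and left special prefixes of the Fibonacci word *)

Lemma mkseq_prefix (A : Type) (x : nat -> A) w w' N :
  w ++ w' = mkseq x N -> w = mkseq x (size w).
Proof.
move=> E; have := congr1 (take (size w)) E; rewrite take_size_cat // take_mkseq //.
by have := congr1 size E; rewrite size_cat size_mkseq => <-; rewrite leq_addr.
Qed.

Lemma count_mem_bool w : count_mem false w + count_mem true w = size w.
Proof. by rewrite -(count_predC (pred1 true) w) addnC; congr (_ + _); apply: eq_count => -[]. Qed.

Lemma count_true_extend_fib w :
  count_mem true (extend fib_morphism w) = count_mem false w.
Proof. by elim: w => //= c w IH; rewrite [extend _ _]/(_ ++ extend _ _) count_cat IH; case: c. Qed.

Lemma fib_extendS x m : fixed_point fib_morphism x ->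
  mkseq (fun j => x (size (extend fib_morphism (mkseq x m)) + j))
    (size (fib_morphism (x m))) = fib_morphism (x m).
Proof.
move=> [hx _]; have := hx m.+1; rewrite /= extend_mkseqS size_cat mkseqD -hx.
by move/(congr1 (drop (size (extend fib_morphism (mkseq x m))))); rewrite !drop_size_cat.
Qed.

(* Desubstitution: prefixes of lengths [m], [m'] and [m + m' + 1] have Fibonacci
   images of lengths close to [i], [n] and [i + n + 1]. *)
Lemma fib_balanced x i n : fixed_point fib_morphism x ->
  count_mem true (mkseq x i) + count_mem true (mkseq x n)
    <= count_mem true (mkseq x (i + n).+1)
    <= (count_mem true (mkseq x i) + count_mem true (mkseq x n)).+1.
Proof.
move=> hx; pose f k := count_mem true (mkseq x k).
suff : f i + f n <= f (i + n).+1 <= (f i + f n).+1 by [].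
pose h k := count_mem false (mkseq x k).
have hf k : h k + f k = k by rewrite /h /f count_mem_bool size_mkseq.
have fS k : f k.+1 = f k + x k by rewrite /f mkseqS -cats1 count_cat /= addn0; case: (x k).
pose l m := m + h m.
have lE m : l m = size (extend fib_morphism (mkseq x m)).
  by rewrite size_extend_fib size_mkseq.
have fl m : f (l m) = h m.
  by rewrite /f lE -(hx.1 m) count_true_extend_fib.
have block m : x (l m) = false /\ l m.+1 = (l m).+1 + ~~ x m.
  have := fib_extendS m hx; rewrite -lE => E; split=> //.
    by move: E; case: (x m); rewrite /mkseq /= addn0; case.
  by rewrite !lE extend_mkseqS size_cat; case: (x m); rewrite ?addn2 ?addn1 ?addn0.
(* A cut inside an image [01] ([e = 1]) falls before its [1]; thus the ones seen so far match the
   zeros among the first [m] letters. *)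
have desub k : exists m e, [/\ e <= 1, k = l m + e, e <= ~~ x m & f k = h m].
  elim: k => [|k [m [e [e1 Ek em fk]]]]; first by exists 0, 0.
  have [x0 lS] := block m.
  case: e e1 Ek em => [|[|//]] _ Ek em; last first.
    exists m.+1, 0; rewrite addn0 -fl; suff -> : k.+1 = l m.+1 by [].
    by rewrite lS; move: em; case: (x m) => //=; lia.
  case xm: (x m) lS em => lS em; last first.
    by exists m, 1; rewrite xm fS fk Ek addn0 x0 addn0; split=> //; lia.
  exists m.+1, 0; rewrite addn0 -fl; suff -> : k.+1 = l m.+1 by [].
  by rewrite lS; lia.
have h_gt0 m : 0 < m -> 0 < h m.
  case: m => // m _; have [x0 _] := block 0.
  by rewrite /h (mkseqD x 1 m) count_cat -[mkseq x 1]/[:: x (l 0)] x0.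
(* Induction on a bound for [i + n]: since the word begins with [0], [h] is positive on positive
   lengths, and [m + m' < i + n] unless [m = m' = 0]. *)
elim: {i n}(i + n).+1 {-2}i {-2}n (ltnSn (i + n)) => // N IH i n le_N.
have [m [e [e1 Ei _ fi]]] := desub i; have [m' [e' [e'1 En _ fn]]] := desub n.
have : f m + f m' <= f (m + m').+1 <= (f m + f m').+1.
  case: (posnP (m + m')) => [m0|mp].
    have [-> ->] : m = 0 /\ m' = 0 by lia.
    by rewrite fS; case: (x 0).
  apply: IH; have := @h_gt0 m; have := @h_gt0 m'; rewrite /l in Ei En; lia.
have [M EM] : exists M, M = (m + m').+1 by exists (m + m').+1.
rewrite -EM => hM.
have := hf m; have := hf m'; have := hf M.
have [x0 _] := block M; have fM := fl M.
have lM : l M = M + h M by []; have lm : l m = m + h m by []; have lm' : l m' = m' + h m' by [].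
have lM_gt0 : 0 < l M by rewrite lM EM.
have := fS (l M); have := fS (l M).+1; have := fS (l M).-1.
rewrite prednK // x0 fM fi fn addn0 => f1 f2 f3 hfM hfm' hfm.
move: hM lM lm lm' Ei En f1 f2 f3 hfM hfm' hfm.
have [k Ek] : exists k, k = (i + n).+1 by exists (i + n).+1.
rewrite -Ek.
have b1 := leq_b1 (x (l M).-1); have b2 := leq_b1 (x (l M).+1).
move: (nat_of_bool _) b1 => y1 b1; move: (nat_of_bool _) b2 => y2 b2 *.
(* The bounds on [f M] make [l M] equal to [l m + l m'] plus 1 or 2, whereas [k] is that sum plus 1,
   2 or 3. *)
have /or4P [] : [|| k == (l M).-1, k == l M, k == (l M).+1 | k == (l M).+2] by lia.
all: by move/eqP=> E; rewrite E; lia.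
Qed.

(** The image of a letter [d] ends with [~~ d]. So if [d] precedes an occurrence of a prefix, then
    [~~ d] precedes an occurrence of its image, a longer prefix: the induction swaps the two
    letters. *)
Lemma fib_left_special x c n : fixed_point fib_morphism x ->
  exists p, p ++ c :: mkseq x n = mkseq x (size p + n.+1).
Proof.
move=> [hx _]; pose P c n := exists p, p ++ c :: mkseq x n = mkseq x (size p + n.+1).
suff : P true n /\ P false n by case: c => -[].
have P_le k k' d : k' <= k -> P d k -> P d k'.
  move=> le_k [p E]; exists p.
  have -> : p ++ d :: mkseq x k' = take (size p + k'.+1) (p ++ d :: mkseq x k).
    by rewrite take_cat ltnNge leq_addr /= addKn /= take_mkseq.
  by rewrite E take_mkseq // leq_add2l.
have PS d k : P d k -> P (~~ d) (size (extend fib_morphism (mkseq x k))).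
  move=> [p /(congr1 (extend fib_morphism)) E].
  rewrite hx -cat1s !extend_cat extend_seq1 [extend _ (mkseq x k)]hx in E.
  pose r := if d then [::] else [:: false].
  have Er : fib_morphism d = r ++ [:: ~~ d] by rewrite /r; case: d {E r}.
  exists (extend fib_morphism p ++ r).
  rewrite Er -catA /= in E; rewrite -catA E; congr mkseq.
  by have := congr1 size E; rewrite !size_cat /= !size_mkseq => <-; rewrite addnA.
have x2 : [:: false; true] = mkseq x 2.
  by have := hx 1; rewrite /extend /mkseq /=; case x0: (x 0); rewrite /= ?x0.
have := hx 2; rewrite -x2 => x3; have := hx 3; rewrite -[mkseq x 3]x3 => x5.
have x1 : [:: false] = mkseq x 1 by apply: (@mkseq_prefix _ _ _ [:: true] 2).
elim: n => [|n [Pt Pf]].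
  by split; [exists [:: false]|exists [::]].
(* The image of the empty prefix is no longer than it, so length 1 is read off from the first
   letters [01001]. *)
case: n Pt Pf => [_ _|n Pt Pf].
  split; [exists [:: false]|exists [:: false; true]]; rewrite -x1 //=.
  by apply: (@mkseq_prefix _ _ _ [:: true] 5).
have le_n : n.+2 <= size (extend fib_morphism (mkseq x n.+1)).
  by rewrite size_extend_fib size_mkseq (mkseqD x 1 n) count_cat -[mkseq x 1]x1 /=; lia.
by split; apply: P_le le_n _; [apply: (PS false)|apply: (PS true)].
Qed.

(** * Weights of the factors *)

(** By balance, a factor of length [n.+1] has as many ones as the prefix of length [n], or one more,
    so it weighs as much as that prefix with one letter added. Left speciality realizes both
    letters. *)
Lemma factor_weights a b x : fixed_point fib_morphism x ->
  (weight a b @` nonempty_factors x = [set s | exists (c : bool) n,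
    s = weight a b [:: c] + weight a b (mkseq x n)])%classic.
Proof.
move=> hx; have weight_cat v w : weight a b (v ++ w) = weight a b v + weight a b w.
  by rewrite /weight !count_cat; lia.
apply/seteqP; split=> s /= => [[w [w0 [i Ew]] <-]|[c [n ->]]]; last first.
  have [p Ep] := fib_left_special c n hx.
  exists (c :: mkseq x n); last by rewrite -cat1s weight_cat.
  split=> //; exists (size p); rewrite /= size_mkseq.
  by move: Ep; rewrite mkseqD => /(congr1 (drop (size p))); rewrite !drop_size_cat ?size_mkseq.
have [n sw] : exists n, size w = n.+1 by case: w w0 {Ew} => // c w; exists (size w).
rewrite sw in Ew.
have := fib_balanced i n hx.
rewrite -addnS mkseqD -Ew count_cat => hb.
have := count_mem_bool w; have := count_mem_bool (mkseq x n); rewrite sw size_mkseq => hn hw.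
exists (count_mem true w != count_mem true (mkseq x n)), n; rewrite /weight.
case: eqP => [E|E] /=.
  have -> : count_mem false w = (count_mem false (mkseq x n)).+1 by lia.
  by rewrite E muln1 muln0 mulnS addn0 addnA.
have -> : count_mem true w = (count_mem true (mkseq x n)).+1 by lia.
have -> : count_mem false w = count_mem false (mkseq x n) by lia.
by rewrite muln1 muln0 mulnS add0n addnCA.
Qed.

(** * The Fibonacci word preceded by a letter *)

(* The fixed points starting with [g] of these two morphisms are [g] followed by
   the Fibonacci word: they are conjugate to the square of [fib_morphism]. *)
Definition fib_conjugate (g c : bool) : seq bool :=
  match g, c with
  | true, true => [:: true; false]
  | true, false => [:: true; false; false]
  | false, true => [:: false; true]
  | false, false => [:: false; false; true]
  end.

Definition scons (A : Type) (g : A) (x : nat -> A) (n : nat) : A :=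
  if n is m.+1 then x m else g.

Lemma mkseq_scons (A : Type) (g : A) x n : mkseq (scons g x) n.+1 = g :: mkseq x n.
Proof. by rewrite (mkseqD (scons g x) 1). Qed.

(** Write [fib_conjugate g g] as [g :: t]. For each letter [c], [t ++ fib_conjugate g c = fib2
    [:: c] ++ t], so [t] moves through the word to its end. *)
Lemma fib_conjugate_fixed g x :
  fixed_point fib_morphism x -> fixed_point (fib_conjugate g) (scons g x).
Proof.
move=> [hx _].
pose fib2 w := extend fib_morphism (extend fib_morphism w).
have conj w : exists t t', extend (fib_conjugate g) (g :: w) = g :: fib2 w ++ t
    /\ t ++ t' = [:: false; true].
  exists (if g then [:: false] else [:: false; true]), (if g then [:: true] else [::]).
  split; last by case: (g).
  rewrite -cat1s extend_cat extend_seq1.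
  have -> : fib_conjugate g g = g :: if g then [:: false] else [:: false; true].
    by case: (g).
  rewrite cat_cons; congr (_ :: _); elim: w => [|c w IH]; first by case: (g).
  have -> : fib2 (c :: w) = fib2 [:: c] ++ fib2 w by rewrite /fib2 -cat1s !extend_cat.
  rewrite -catA -IH -(cat1s c w) extend_cat extend_seq1 !catA.
  by congr (_ ++ _); case: (g); case: (c).
split=> [n|k] /=; last first.
  exists k; have := @size_extend_ge _ _ (fib_conjugate g) 1 (mkseq (scons g x) k).
  by rewrite size_mkseq mul1n; apply; case: (g) => -[].
case: n => // n; rewrite mkseq_scons; have [t [t' [-> Et]]] := conj (mkseq x n).
rewrite /= mkseq_scons; congr (_ :: _).
have E : fib2 (mkseq x n.+1) = mkseq x (size (fib2 (mkseq x n.+1))).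
  by rewrite /fib2 hx; apply: hx.
(* The trailing [t] is a prefix of [01], with which the [fib2] image of the next letter begins. *)
have [r Er] : exists r, fib2 (mkseq x n.+1) = (fib2 (mkseq x n) ++ t) ++ r.
  rewrite /fib2 extend_mkseqS extend_cat.
  exists (t' ++ drop 2 (extend fib_morphism (fib_morphism (x n)))).
  by rewrite -catA; congr (_ ++ _); rewrite catA Et; case: (x n).
exact: mkseq_prefix (etrans (esym Er) E).
Qed.

(** * Differences of the Fibonacci gaps *)

Theorem theorem6 (a b : nat) (ha : 0 < a) (hb : 0 < b)
    (xF : nat -> bool) (hxF : fixed_point fib_morphism xF)
    (hinf : infinite_set (weight_gaps a b xF))
    (C : nat -> nat) (hC : increasing_enumeration (weight_gaps a b xF) C) :
  exists (tau : bool -> seq bool) (z : nat -> bool) (delta : bool -> seq nat),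
    [/\ fixed_point tau z,
        forall c k, k \in delta c -> 0 < k &
        maps_to delta z (differences C)].
Proof.
(* With a heaviest letter in front, replacing [g] by the other letter lowers the weight by exactly
   [D]. *)
pose g := a <= b; pose z := scons g xF; have hz := fib_conjugate_fixed g hxF.
pose W c := if c then b else a; pose D := maxn a b - minn a b.
have weightE w : weight a b w = letter_sum W w.
  rewrite /weight /letter_sum; elim: w => [|c w IH] /=; first by rewrite !muln0.
  by rewrite -IH; case: (c); rewrite /= add0n mulnDr muln1 !addnA // [_ + b]addnC.
suff E : weight_gaps a b xF = [set n | 0 < n /\ forall j,
    letter_sum W (mkseq z j) <> n /\ letter_sum W (mkseq z j) <> n + D]%classic.
  have W_gt0 c : 0 < W c by case: c.
  rewrite E in hC.
  have [c|c|delta [hd hm]] := gap_differences_morphic W_gt0 hz _ _ hC.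
  - by case: (g); case: c.
  - by rewrite /z /=; case: (g); case: c.
  by exists (fib_conjugate g), z, delta.
have weight1 c : weight a b [:: c] = W c by rewrite weightE /letter_sum /= addn0.
have WD c : W g = W c + D * (c != g) by rewrite /W /D /g; case: c; case: leqP => /=; lia.
have prefixE j : letter_sum W (mkseq z j.+1) = W g + weight a b (mkseq xF j).
  by rewrite mkseq_scons weightE.
rewrite /weight_gaps factor_weights //; apply/seteqP; split=> n [/= n0 h]; split=> //.
  (* The empty prefix of [z] weighs 0, which is neither [n] nor [n + D] because [n] is positive. *)
  move=> [|j]; first by rewrite /letter_sum /=; lia.
  rewrite prefixE; split=> Ej; apply: h; [exists g, j|exists (~~ g), j]; rewrite weight1 //.
  by have := WD (~~ g); case: (g) Ej => /=; lia.
move=> [c [j]]; rewrite weight1 => Ej; have [] := h j.+1; rewrite prefixE.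
by have := WD c; case: (c != g); lia.
Qed.
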